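(* Let $E=E(R/\mathfrak m)$ and let $0\neq N\subseteq E$ be an $R$-submodule. The following are equivalent: (i) $N$ is simple-$\mathcal F$-divisible; (ii) $\mathrm{Ann}_{\hat R}(N)$ is a maximal element of the set $\{P\in\mathrm{Spec}(\hat R): P\cap R\notin\mathcal F\}$. If in addition the extension $R\subseteq\hat R$ satisfies going up, then (i) and (ii) are further equivalent to: (iii) $N$ is strongly coprime and $\mathrm{Ann}_R(N)\in\mathcal F^*$.
   Context: Throughout, $R$ is a commutative Noetherian local ring with maximal ideal $\mathfrak m$, $\hat R$ its $\mathfrak m$-adic completion, $E(R/\mathfrak m)$ the injective hull of $R/\mathfrak m$ (naturally an $\hat R$-module). $\mathcal F$ is a Gabriel topology on $R$: a nonempty set of ideals of $R$ such that (1) if $\mathfrak a\in\mathcal F$ and $\mathfrak a\subseteq\mathfrak b$ then $\mathfrak b\in\mathcal F$; (2) if $\mathfrak a,\mathfrak b\in\mathcal F$ then $\mathfrak a\cap\mathfrak b\in\mathcal F$; (3) if $\mathfrak b$ is an ideal and there is $\mathfrak a\in\mathcal F$ with $(\mathfrak b:r)\in\mathcal F$ for all $r\in\mathfrak a$, then $\mathfrak b\in\mathcal F$. A module $X$ is $\mathcal F$-divisible if $\mathfrak aX=X$ for all $\mathfrak a\in\mathcal F$. $N$ is simple-$\mathcal F$-divisible if $N\ne0$, $N$ is $\mathcal F$-divisible, and no submodule $0\neq V\subsetneq N$ is $\mathcal F$-divisible. $\mathcal F^*$ denotes the set of maximal elements (under inclusion) of $\mathrm{Spec}(R)\setminus\mathcal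 F$. A module $N\neq0$ is strongly coprime if every nonzero $R$-endomorphism of $N$ is surjective. $R\subseteq\hat R$ satisfies going up if for primes $\mathfrak p\subseteq\mathfrak q$ of $R$ and a prime $P$ of $\hat R$ with $P\cap R=\mathfrak p$ there is a prime $Q\supseteq P$ of $\hat R$ with $Q\cap R=\mathfrak q$. *)

(* Defs.v *)
From HB Require Import structures.
From mathcomp Require Import all_boot all_algebra.
Set Implicit Arguments. Unset Strict Implicit. Unset Printing Implicit Defensive.
Import GRing.Theory.
Local Open Scope ring_scope.

Section Ideals.
Variable R : comNzRingType.

Definition subI (I J : R -> Prop) := forall x, I x -> J x.

Definition is_ideal (I : R -> Prop) :=
  [/\ I 0, (forall x y, I x -> I y -> I (x + y)) & (forall r x, I x -> I (r * x))].

Definition is_prime (I : R -> Prop) :=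
  [/\ is_ideal I, ~ I 1 & forall a b, I (a * b) -> I a \/ I b].

Definition is_local_max (m : R -> Prop) :=
  [/\ is_ideal m, ~ m 1 & forall I, is_ideal I -> ~ I 1 -> subI I m].

Definition noetherian :=
  forall I : nat -> R -> Prop, (forall n, is_ideal (I n)) ->
    (forall n, subI (I n) (I n.+1)) ->
    exists k, forall n, (k <= n)%N -> subI (I n) (I k).

Inductive prod_ideal (I J : R -> Prop) : R -> Prop :=
| prod_ideal0 : prod_ideal I J 0
| prod_idealM a b : I a -> J b -> prod_ideal I J (a * b)
| prod_idealD x y : prod_ideal I J x -> prod_ideal I J y -> prod_ideal I J (x + y).

Fixpoint ideal_pow (m : R -> Prop) (n : nat) : R -> Prop :=
  match n with
  | 0 => fun _ => True
  | n'.+1 => prod_ideal m (ideal_pow m n')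
  end.

Definition colon (b : R -> Prop) (r : R) : R -> Prop := fun x => b (x * r).

Definition gabriel_topology (F : (R -> Prop) -> Prop) :=
  [/\ (exists a, F a),
      (forall a, F a -> is_ideal a),
      (forall a b, F a -> is_ideal b -> subI a b -> F b),
      (forall a b, F a -> F b -> F (fun x => a x /\ b x)) &
      (forall b, is_ideal b ->
         (exists2 a, F a & forall r, a r -> F (colon b r)) -> F b)].

Definition Fstar (F : (R -> Prop) -> Prop) (P : R -> Prop) :=
  [/\ is_prime P, ~ F P &
      forall Q, is_prime Q -> ~ F Q -> subI P Q -> subI Q P].
End Ideals.

Section Modules.
Variables (R : comNzRingType) (E : lmodType R).

Definition subM (X Y : E -> Prop) := forall x, X x -> Y x.

Definition submodule (N : E -> Prop) :=
  [/\ N 0, (forall x y, N x -> N y -> N (x + y)) & (forall r x, N x -> N (r *: x))].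

Definition nonzeroM (N : E -> Prop) := exists x, N x /\ x <> 0.

Inductive ideal_mod (a : R -> Prop) (X : E -> Prop) : E -> Prop :=
| ideal_mod0 : ideal_mod a X 0
| ideal_modZ r x : a r -> X x -> ideal_mod a X (r *: x)
| ideal_modD x y : ideal_mod a X x -> ideal_mod a X y -> ideal_mod a X (x + y).

Definition F_divisible (F : (R -> Prop) -> Prop) (X : E -> Prop) :=
  forall a, F a -> forall x, X x <-> ideal_mod a X x.

Definition simple_F_divisible (F : (R -> Prop) -> Prop) (N : E -> Prop) :=
  [/\ nonzeroM N, F_divisible F N &
      forall V, submodule V -> subM V N -> nonzeroM V -> ~ subM N V ->
        ~ F_divisible F V].

Definition annR (N : E -> Prop) : R -> Prop := fun r => forall x, N x -> r *: x = 0.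

(** strongly coprime: every nonzero R-endomorphism of N is surjective.
    An endomorphism of N is represented by a function E -> E mapping N into N
    and R-linear on N (its values outside N are irrelevant). *)
Definition strongly_coprime (N : E -> Prop) :=
  nonzeroM N /\
  forall f : E -> E,
    (forall x, N x -> N (f x)) ->
    (forall a x y, N x -> N y -> f (a *: x + y) = a *: f x + f y) ->
    (exists x, N x /\ f x <> 0) ->
    forall y, N y -> exists x, N x /\ f x = y.

Definition injective_module :=
  forall (A B : lmodType R) (f : A -> B) (g : A -> E),
    (forall a x y, f (a *: x + y) = a *: f x + f y) ->
    (forall a x y, g (a *: x + y) = a *: g x + g y) ->
    injective f ->
    exists h : B -> E,
      (forall a x y, h (a *: x + y) = a *: h x + h y) /\ forall x, h (f x) = g x.

(** E is an injective hull E(R/m): E is injective and contains a copy R e0 of R/m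
    (Ann_R(e0) = m) as an essential submodule. *)
Definition injective_hull_residue (m : R -> Prop) :=
  injective_module /\
  exists e0 : E, (forall r, r *: e0 = 0 <-> m r) /\
    forall V, submodule V -> nonzeroM V -> exists r, V (r *: e0) /\ r *: e0 <> 0.
End Modules.

Section Completion.
Variables (R S : comNzRingType) (phi : {rmorphism R -> S}).

Inductive ext_ideal (I : R -> Prop) : S -> Prop :=
| ext_ideal0 : ext_ideal I 0
| ext_idealM s x : I x -> ext_ideal I (s * phi x)
| ext_idealD x y : ext_ideal I x -> ext_ideal I y -> ext_ideal I (x + y).

(** phi : R -> S is (isomorphic to) the m-adic completion R -> lim R/m^n :
    R/m^n -> S/m^n S is bijective for all n, and S is m S-adically separated
    and complete. *)
Definition is_completion (m : R -> Prop) :=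
  [/\ (forall n s, exists r, ext_ideal (ideal_pow m n) (s - phi r)),
      (forall n r, ext_ideal (ideal_pow m n) (phi r) -> ideal_pow m n r),
      (forall s, (forall n, ext_ideal (ideal_pow m n) s) -> s = 0) &
      (forall u : nat -> S, (forall n, ext_ideal (ideal_pow m n) (u n.+1 - u n)) ->
         exists s, forall n, ext_ideal (ideal_pow m n) (s - u n))].

Definition contr (P : S -> Prop) : R -> Prop := fun r => P (phi r).

Definition going_up :=
  forall p q : R -> Prop, is_prime p -> is_prime q -> subI p q ->
  forall P : S -> Prop, is_prime P -> (forall r, contr P r <-> p r) ->
  exists Q : S -> Prop, [/\ is_prime Q, subI P Q & forall r, contr Q r <-> q r].

(** Ann_{\hat R}(N) for the natural \hat R-module structure on the m-torsion
    module E: s acts on x as r acts on x, where m^n x = 0 and s - phi r \in m^n S. *)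
Definition annS (m : R -> Prop) (E : lmodType R) (N : E -> Prop) : S -> Prop :=
  fun s => forall x, N x -> forall n r,
    (forall t, ideal_pow m n t -> t *: x = 0) ->
    ext_ideal (ideal_pow m n) (s - phi r) -> r *: x = 0.

Definition max_nonF_prime (F : (R -> Prop) -> Prop) (A : S -> Prop) :=
  [/\ is_prime A, ~ F (contr A) &
      forall P, is_prime P -> ~ F (contr P) -> subI A P -> subI P A].
End Completion.

(* Main.v *)
(* By Matlis duality the submodules of [E] correspond to the ideals of the
   completion [S]: [V = Ann_E (Ann_S V)] and [J = Ann_S (Ann_E J)].  Since
   [Ann_S (a V) = (Ann_S V : a)], divisibility of [V] says that no [a] in [F] has a
   zero divisor modulo [Ann_S V].  Hence minimal divisible submodules are the
   annihilators of the primes of [S] maximal among those not contracting into [F].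

   Duality rests on [End E = S], which is proved on the annihilators of the powers
   of [m] by induction, using the injectivity of [E], and on [E] being Artinian.
   Both make [S] Noetherian.

   With going up, a prime [I] of [S] over a member of [F^*] is already maximal
   because fibres contain no proper inclusion of primes: otherwise a prime [q] of
   [R] just above [p] would yield a chain [I < P < Q] with [Q] minimal over
   [I + (a)], against Krull's principal ideal theorem. *)
Require Import Defs.
From HB Require Import structures.
From mathcomp Require Import all_boot all_algebra.
From mathcomp Require Import boolp ring.

Set Implicit Arguments.
Unset Strict Implicit.
Unset Printing Implicit Defensive.
Import GRing.Theory.
Local Open Scope ring_scope.

(** * Ideals of Noetherian rings *)

Lemma dependent_choice (T : Type) (P : T -> Prop) (lt : T -> T -> Prop) :
  (exists x, P x) -> (forall x, P x -> exists2 y, P y & lt x y) ->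
  exists u : nat -> T, (forall n, P (u n)) /\ forall n, lt (u n) (u n.+1).
Proof.
case=> x0 Px0 step.
have /choice[f fP] : forall x : {x | P x}, exists y : {x | P x}, lt (sval x) (sval y).
  by case=> x Px; have [y Py xy] := step x Px; exists (exist _ y Py).
exists (fun n => sval (iter n f (exist _ x0 Px0))); split=> n.
  exact: svalP.
exact: fP.
Qed.

Section IdealTheory.
Variable R : comNzRingType.
Implicit Types (I J K P Q : R -> Prop) (x y r : R).

Lemma ideal0 I : is_ideal I -> I 0. Proof. by case. Qed.

Lemma idealD I x y : is_ideal I -> I x -> I y -> I (x + y).
Proof. by case=> _ + _; apply. Qed.

Lemma ideal_mull I r x : is_ideal I -> I x -> I (r * x).
Proof. by case=> _ _; apply. Qed.

Lemma ideal_mulr I r x : is_ideal I -> I x -> I (x * r).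
Proof. by rewrite mulrC; exact: ideal_mull. Qed.

Lemma idealN I x : is_ideal I -> I x -> I (- x).
Proof. by move=> idI Ix; rewrite -mulN1r; exact: ideal_mull. Qed.

Lemma idealB I x y : is_ideal I -> I x -> I y -> I (x - y).
Proof. by move=> idI Ix Iy; apply: idealD => //; exact: idealN. Qed.

Lemma prime_ideal P : is_prime P -> is_ideal P. Proof. by case. Qed.

Lemma prime_notM P x y : is_prime P -> ~ P x -> ~ P y -> ~ P (x * y).
Proof. by case=> _ _ PM nx ny /PM[]. Qed.

Lemma prime_not1 P : is_prime P -> ~ P 1. Proof. by case. Qed.

Lemma primeMr P x y : is_prime P -> P (x * y) -> ~ P y -> P x.
Proof. by case=> _ _ PM /PM[]. Qed.

Lemma prime_notX P x n : is_prime P -> ~ P x -> ~ P (x ^+ n).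
Proof.
move=> prP nx; elim: n => [|n IHn]; first exact: prime_not1.
by rewrite exprS; exact: prime_notM.
Qed.

Lemma noetherian_max (T : (R -> Prop) -> Prop) : noetherian R ->
  (exists2 I, is_ideal I & T I) ->
  exists I, [/\ is_ideal I, T I & forall J, is_ideal J -> T J -> subI I J -> subI J I].
Proof.
move=> noethR [I0 idI0 TI0]; apply: contrapT => nomax.
have [] := @dependent_choice _ (fun I => is_ideal I /\ T I)
  (fun I J => subI I J /\ ~ subI J I).
- by exists I0.
- move=> I [idI TI]; apply: contrapT => noJ; apply: nomax; exists I; split=> //.
  move=> J idJ TJ IJ; apply: contrapT => nJI; apply: noJ.
  by exists J.
- move=> u [uP u_incr].
  have [||k kP] := noethR u; first by move=> n; case: (uP n).
    by move=> n; case: (u_incr n).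
  by case: (u_incr k) => _; apply; exact: kP.
Qed.

Definition add_principal I x : R -> Prop := fun y => exists c, I (y - c * x).

Lemma add_principal_ideal I x : is_ideal I -> is_ideal (add_principal I x).
Proof.
move=> idI; split.
- by exists 0; rewrite mul0r subr0; exact: ideal0.
- move=> y z [c Ic] [d Id]; exists (c + d).
  have -> : y + z - (c + d) * x = (y - c * x) + (z - d * x) by ring.
  exact: idealD.
- move=> r y [c Ic]; exists (r * c).
  have -> : r * y - r * c * x = r * (y - c * x) by ring.
  exact: ideal_mull.
Qed.

Lemma add_principal_sub I x : subI I (add_principal I x).
Proof. by move=> y Iy; exists 0; rewrite mul0r subr0. Qed.

Lemma add_principal_id I x : is_ideal I -> add_principal I x x.
Proof. by move=> idI; exists 1; rewrite mul1r subrr; exact: ideal0. Qed.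

Lemma colon_ideal I x : is_ideal I -> is_ideal (colon I x).
Proof.
move=> idI; rewrite /colon; split; first by rewrite mul0r; exact: ideal0.
- by move=> y z; rewrite mulrDl; exact: idealD.
- by move=> r y; rewrite -mulrA; exact: ideal_mull.
Qed.

Lemma colon_sub I x : is_ideal I -> subI I (colon I x).
Proof. by move=> idI y Iy; exact: ideal_mulr. Qed.

(** A maximal annihilator in [R / I] is prime: if [a * b] lies in [(I : x)] and [b * x] is not in
    [I], then [(I : b x)] contains [(I : x)], hence equals it, and it contains [a]. *)
Lemma max_colon_prime I x : is_ideal I -> ~ I x ->
  (forall y, ~ I y -> subI (colon I x) (colon I y) -> subI (colon I y) (colon I x)) ->
  is_prime (colon I x).
Proof.
move=> idI nIx maxx; split; first exact: colon_ideal.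
  by rewrite /colon mul1r.
move=> a b Iab; have [Ibx|nIbx] := pselect (I (b * x)); first by right.
left; apply: (maxx (b * x)) => //.
  by rewrite /colon => c Ic; rewrite mulrCA; exact: ideal_mull.
by rewrite /colon mulrA.
Qed.

Fixpoint lspan (l : seq R) : R -> Prop :=
  if l is a :: l' then add_principal (lspan l') a else fun x => x = 0.

Lemma lspan_ideal l : is_ideal (lspan l).
Proof.
elim: l => [|a l IHl] /=; last exact: add_principal_ideal.
by split=> // [x y -> ->|r x ->]; rewrite ?addr0 ?mulr0.
Qed.

Lemma lspan_mem l a : a \in l -> lspan l a.
Proof.
elim: l => //= b l IHl; rewrite inE => /predU1P[->|/IHl].
  by apply: add_principal_id; exact: lspan_ideal.
exact: add_principal_sub.
Qed.

Lemma lspan_sub l I : is_ideal I -> (forall a, a \in l -> I a) -> subI (lspan l) I.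
Proof.
move=> idI; elim: l => [|a l IHl] lI x /=; first by move=> ->; exact: ideal0.
case=> c /IHl Ix; rewrite -[x](subrK (c * a)); apply: idealD => //.
  by apply: Ix => b bl; apply: lI; rewrite inE bl orbT.
by apply: ideal_mull => //; apply: lI; rewrite mem_head.
Qed.

Lemma noetherian_fg I : noetherian R -> is_ideal I ->
  exists2 l : seq R, (forall a, a \in l -> I a) & subI I (lspan l).
Proof.
move=> noethR idI.
have [|J [idJ [l lI lJ] maxJ]] := @noetherian_max
  (fun J => exists2 l : seq R, (forall a, a \in l -> I a) & J = lspan l) noethR.
  by exists (lspan [::]); [exact: lspan_ideal|exists [::]].
exists l => // x Ix; rewrite -lJ; apply: (maxJ (lspan (x :: l))).
- exact: lspan_ideal.
- by exists (x :: l) => // a; rewrite inE => /predU1P[->//|]; exact: lI.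
- by rewrite lJ; exact: add_principal_sub.
- by apply: lspan_mem; rewrite mem_head.
Qed.

Lemma local_unit (m : R -> Prop) r : is_local_max m -> ~ m r -> exists s, s * r = 1.
Proof.
case=> idm nm1 maxm nmr; apply: contrapT => nunit; apply: nmr.
apply: (maxm (fun x => exists s, s * r = x)); last by exists 1; rewrite mul1r.
  split; first by exists 0; rewrite mul0r.
  - by move=> x y [s <-] [t <-]; exists (s + t); rewrite mulrDl.
  - by move=> t x [s <-]; exists (t * s); rewrite mulrA.
by case=> s sr; apply: nunit; exists s.
Qed.

Lemma local_max_prime (m : R -> Prop) : is_local_max m -> is_prime m.
Proof.
move=> locm; have [idm nm1 _] := locm; split=> // a b mab.
have [ma|nma] := pselect (m a); [by left|right].
have [s sa1] := local_unit locm nma.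
by rewrite -[b]mul1r -sa1 -mulrA; exact: ideal_mull.
Qed.

Lemma local_prime_sub (m : R -> Prop) P : is_local_max m -> is_prime P -> subI P m.
Proof. by case=> _ _ maxm [idP nP1 _]; exact: maxm. Qed.

(* For [K] the intersection of the primes containing [J], a maximal proper
   colon ideal [(K : t)] is a minimal prime over [J]. *)
Lemma minimal_prime J P : noetherian R -> is_prime P -> subI J P ->
  exists q, [/\ is_prime q, subI J q &
    forall q', is_prime q' -> subI J q' -> subI q' q -> subI q q'].
Proof.
move=> noethR prP JP.
pose K x := forall q, is_prime q -> subI J q -> q x.
have idK : is_ideal K.
  split=> [q /prime_ideal idq _|x y Kx Ky q prq Jq|r x Kx q prq Jq].
  - exact: ideal0.
  - by apply: (idealD (prime_ideal prq)); [exact: Kx|exact: Ky].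
  - by apply: (ideal_mull _ (prime_ideal prq)); exact: Kx.
have [|q [idq [t nKt qE] maxq]] := @noetherian_max
  (fun I => exists2 t, ~ K t & I = colon K t) noethR.
  exists (colon K 1); first exact: colon_ideal.
  by exists 1 => // /(_ P prP JP); exact: prime_not1.
(* [K] is radical, so [t * t] in [K] would put [t] in [K]. Hence a prime inside [q] omits [t] as
   well. *)
have nqt : ~ q t.
  rewrite qE => Ktt; apply: nKt => q' prq' Jq'.
  by have [_ _ /(_ t t (Ktt q' prq' Jq'))[]] := prq'.
exists q; split.
- rewrite qE; apply: max_colon_prime => // y nKy.
  by rewrite -qE; apply: maxq; [exact: colon_ideal|exists y].
- rewrite qE => x Jx q' prq' Jq'; apply: (ideal_mulr _ (prime_ideal prq')); exact: Jq'.
- move=> q' prq' Jq' q'q x; rewrite qE => Kxt.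
  by apply: (primeMr prq' (Kxt q' prq' Jq')) => /q'q.
Qed.

End IdealTheory.

(** * Krull's principal ideal theorem *)

Section PrincipalIdealTheorem.
Variable S : comNzRingType.
Implicit Types (I J L M P Q : S -> Prop) (b f s t x : S).

(** Saturated ideals stand for the ideals of the localization at [Q], which is never constructed. *)
Definition saturated Q I := forall t x, ~ Q t -> I (t * x) -> I x.

(* The contraction to [S] of the extension of [I + (x)] to the localization
   at the prime [Q]. *)
Definition sat_add Q I x : S -> Prop :=
  fun y => exists2 t, ~ Q t & add_principal I x (t * y).

Section Saturation.
Variable Q : S -> Prop.
Hypothesis prQ : is_prime Q.

Lemma sat_add_ideal I x : is_ideal I -> is_ideal (sat_add Q I x).
Proof.
move=> idI; have idA := add_principal_ideal x idI; split.
- by exists 1; [exact: prime_not1|rewrite mulr0; exact: ideal0].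
- move=> y z [t nt ty] [u nu uz]; exists (t * u); first exact: prime_notM.
  have -> : t * u * (y + z) = u * (t * y) + t * (u * z) by ring.
  by apply: idealD => //; exact: ideal_mull.
- by move=> r y [t nt ty]; exists t => //; rewrite mulrCA; exact: ideal_mull.
Qed.

Lemma sat_add_saturated I x : saturated Q (sat_add Q I x).
Proof.
move=> t y nt [u nu Iuty]; exists (u * t); first exact: prime_notM.
by rewrite -mulrA.
Qed.

Lemma add_principal_sat_add I x : subI (add_principal I x) (sat_add Q I x).
Proof. by move=> y Iy; exists 1; [exact: prime_not1|rewrite mul1r]. Qed.

Lemma sat_add_sub I x : subI I (sat_add Q I x).
Proof. by move=> y /(add_principal_sub x); exact: add_principal_sat_add. Qed.

Lemma sat_add_id I x : is_ideal I -> sat_add Q I x x.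
Proof. by move=> idI; apply: add_principal_sat_add; exact: add_principal_id. Qed.

Lemma sat_add_mono I J x : subI I J -> subI (sat_add Q I x) (sat_add Q J x).
Proof. by move=> IJ y [t nt [c Ic]]; exists t => //; exists c; exact: IJ. Qed.

(** Nakayama over the localization at [Q]; [sat_add Q M' 0] is the saturation of [M']. For [L]
    maximal among the saturated ideals containing [M'] but not [M], any [x] in [M] outside [L]
    generates [M] locally modulo [L], which reduces to the case of one generator. *)
Lemma nakayama_principal M M' b : noetherian S -> is_ideal M -> is_ideal M' -> Q b ->
  (forall x, M x -> exists2 t, ~ Q t & exists2 c, M c & M' (t * x - c * b)) ->
  subI M (sat_add Q M' 0).
Proof.
move=> noethS idM idM' Qb MM'; apply: contrapT => nMM'.
have [|L [idL [M'L satL nML] maxL]] := @noetherian_max _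
  (fun L => [/\ subI M' L, saturated Q L & ~ subI M L]) noethS.
  exists (sat_add Q M' 0); first exact: sat_add_ideal.
  by split=> //; [exact: sat_add_sub|exact: sat_add_saturated].
apply: nML => x Mx; apply: contrapT => nLx.
have ML' : subI M (sat_add Q L x).
  apply: contrapT => nML'; apply: nLx.
  apply: (maxL (sat_add Q L x)); last exact: sat_add_id.
  - exact: sat_add_ideal.
  - split=> //; last exact: sat_add_saturated.
    by move=> y /M'L; exact: sat_add_sub.
  - exact: sat_add_sub.
have [t nt [c Mc M'tx]] := MM' x Mx; have [t' nt' [d Ld]] := ML' c Mc.
apply: nLx; apply: (satL (t' * t - d * b)).
  move=> Qtt; apply: (prime_notM prQ nt' nt).
  have idQ := prime_ideal prQ.
  by rewrite -[t' * t](subrK (d * b)); apply: idealD => //; exact: ideal_mull.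
have -> : (t' * t - d * b) * x = t' * (t * x - c * b) + b * (t' * c - d * x) by ring.
by apply: idealD => //; apply: ideal_mull => //; exact: M'L.
Qed.

(** The localization of [S / J] at [Q] is Artinian. *)
Definition local_dcc J := forall D : nat -> S -> Prop,
  (forall n, is_ideal (D n)) -> (forall n, saturated Q (D n)) ->
  (forall n, subI J (D n)) -> (forall n, subI (D n.+1) (D n)) ->
  exists k, forall n, (k <= n)%N -> subI (D k) (D n).

Lemma descending_chain (D : nat -> S -> Prop) k n :
  (forall n, subI (D n.+1) (D n)) -> (k <= n)%N -> subI (D n) (D k).
Proof.
move=> dD /subnK <-; elim: (n - k)%N => [|i IHi] x //.
by rewrite addSn => /dD /IHi.
Qed.

(** Multiplication by [x] gives an exact sequence from [S / (J : x)] through [S / J] to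
    [S / (J + (x))]. The chain [D] is controlled by its preimage in the first term and its image in
    the last. *)
Lemma local_dcc_extension J x : is_ideal J ->
  local_dcc (add_principal J x) -> local_dcc (colon J x) -> local_dcc J.
Proof.
move=> idJ dccA dccC D idD satD JD dD.
have [|n|n y|n|k1 k1P] := dccA (fun n => sat_add Q (D n) x).
- by move=> n; exact: sat_add_ideal.
- exact: sat_add_saturated.
- by case=> c /JD Dc; apply: add_principal_sat_add; exists c.
- exact: sat_add_mono.
have [|n t y nt|n y|n y|k2 k2P] := dccC (fun n => colon (D n) x).
- by move=> n; exact: colon_ideal.
- by rewrite /colon -mulrA; exact: satD.
- exact: JD.
- exact: dD.
exists (maxn k1 k2) => n; rewrite geq_max => /andP[k1n k2n] y Dy.
set k := maxn k1 k2 in Dy; have [k1k k2k] := (leq_maxl k1 k2, leq_maxr k1 k2).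
have [t nt [c Dc]] : sat_add Q (D n) x y.
  by apply: k1P => //; apply: sat_add_sub; exact: (descending_chain dD k1k).
have Dxc : D k (c * x).
  rewrite -[c * x](subKr (t * y)).
  apply: idealB => //; [exact: ideal_mull|].
  by apply: (descending_chain dD _ Dc); rewrite geq_max k1n.
have Dn : colon (D n) x c by apply: k2P => //; exact: (descending_chain dD k2k).
by apply: (satD n t) => //; rewrite -[t * y](subrK (c * x)); exact: idealD.
Qed.

(** Noetherian induction. A maximal failure [J] lies in [Q], since otherwise its localization is
    everything, and is prime by [local_dcc_extension]. So [J = Q] by minimality of [Q], and a field
    has no nontrivial chains of ideals. *)
Lemma local_dcc_minimal I b : noetherian S -> is_ideal I ->
  (forall Q', is_prime Q' -> subI I Q' -> Q' b -> subI Q' Q -> subI Q Q') ->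
  forall J, is_ideal J -> subI I J -> J b -> local_dcc J.
Proof.
move=> noethS idI minQ J0 idJ0 IJ0 J0b; apply: contrapT => ndcc0.
have [|J [idJ [IJ Jb ndcc] maxJ]] := @noetherian_max _
  (fun J => [/\ subI I J, J b & ~ local_dcc J]) noethS.
  by exists J0.
have dccJ J' x : is_ideal J' -> subI J J' -> J' x -> ~ J x -> local_dcc J'.
  move=> idJ' JJ' J'x nJx; apply: contrapT => ndcc'; apply: nJx.
  by apply: (maxJ J') => //; split=> //; [move=> y /IJ /JJ'|exact: JJ'].
have [JQ|/existsNP[t /not_implyP[Jt nQt]]] := pselect (subI J Q); last first.
  apply: ndcc => D idD satD JD dD; exists 0%N => n _ y _.
  by apply: (satD n t) => //; rewrite mulrC; apply: ideal_mull => //; exact: JD.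
have prJ : is_prime J.
  split=> // [/JQ|x y Jxy]; first exact: prime_not1.
  apply: contrapT => /not_orP[nJx nJy].
  apply: ndcc; apply: (@local_dcc_extension _ y) => //.
    apply: (dccJ _ y) => //; first exact: add_principal_ideal.
      exact: add_principal_sub.
    exact: add_principal_id.
  by apply: (dccJ _ x) => //; [exact: colon_ideal|exact: colon_sub].
have QJ := minQ J prJ IJ Jb JQ.
apply: ndcc => D idD satD JD dD.
have [[k DkQ]|/forallNP nDQ] := pselect (exists k, subI (D k) Q).
  by exists k => n kn y /DkQ /QJ; exact: JD.
exists 0%N => n _ y _; have /existsNP[t /not_implyP[Dt nQt]] := nDQ n.
by apply: (satD n t) => //; exact: (ideal_mulr _ (idD n) Dt).
Qed.

End Saturation.

(* With [J n] the symbolic power of [f], i.e. the contraction of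
   [f ^+ n] + [I] from the localization at [P], the descending chain condition
   in the localization at [Q] modulo [b] gives [J k = J k.+1 + b J k] for some
   [k], so [f ^+ k] is in [J k.+1] by Nakayama. *)
Theorem principal_ideal_theorem I P Q b : noetherian S ->
  is_prime I -> is_prime P -> is_prime Q ->
  subI I P -> subI P Q -> Q b -> ~ P b ->
  (forall Q', is_prime Q' -> subI I Q' -> Q' b -> subI Q' Q -> subI Q Q') ->
  subI P I.
Proof.
move=> noethS prI prP prQ IP PQ Qb nPb minQ f Pf; apply: contrapT => nIf.
have [[idI idP] idQ] := (prime_ideal prI, prime_ideal prP, prime_ideal prQ).
pose J n := sat_add P I (f ^+ n).
have idJ n : is_ideal (J n) by exact: sat_add_ideal.
have IJ n : subI I (J n) by exact: sat_add_sub.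
have dJ n : subI (J n.+1) (J n).
  move=> x [t nt [c Ic]]; exists t => //; exists (c * f).
  by rewrite -mulrA -exprS.
have [|n|n|n|k kP] := @local_dcc_minimal Q prQ I b noethS idI minQ
    (add_principal I b) (add_principal_ideal b idI) (@add_principal_sub _ I b)
    (add_principal_id b idI) (fun n => sat_add Q (J n) b).
- by move=> n; exact: sat_add_ideal.
- exact: sat_add_saturated.
- move=> x [c Ic]; apply: add_principal_sat_add => //; exists c; exact: IJ.
- exact: sat_add_mono.
have [x Jx|u nu] := @nakayama_principal Q prQ (J k) (J k.+1) b noethS (idJ k) (idJ k.+1)
    Qb _ (f ^+ k) (sat_add_id prP (f ^+ k) idI).
  have [t nt [c Jc]] := kP k.+1 (leqnSn k) x (sat_add_sub prQ b Jx).
  (* [c * b] lies in [J k], which is saturated at [P], and [b] is outside [P]; so [c] lies in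
     [J k]. *)
  exists t => //; exists c => //; apply: (sat_add_saturated prP nPb).
  rewrite mulrC -[c * b](subKr (t * x)); apply: (idealB (idJ k)).
    exact: (ideal_mull _ (idJ k)).
  exact: dJ.
(* Nakayama puts [t * u * f ^+ k] in [I + (f ^+ k.+1)]. As the prime [I] omits [f], the factor
   [f ^+ k] cancels and [t * u] falls into [P], although neither factor does. *)
case=> c; rewrite mulr0 subr0 => -[t nt [d]].
have -> : t * (u * f ^+ k) - d * f ^+ k.+1 = (t * u - d * f) * f ^+ k.
  by rewrite exprS; ring.
move=> /(primeMr prI) /(_ (prime_notX prI nIf)) /IP Ptu.
have : P (t * u).
  by rewrite -[t * u](subrK (d * f)); apply: idealD => //; exact: ideal_mull.
by apply: (prime_notM prP nt) => /PQ.
Qed.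

End PrincipalIdealTheorem.

(** * Fibres of a ring morphism with going up *)

Section Fibres.
Variables (R S : comNzRingType) (phi : {rmorphism R -> S}) (m : R -> Prop).

Lemma contr_ideal (P : S -> Prop) : is_ideal P -> is_ideal (contr phi P).
Proof.
move=> idP; rewrite /contr; split; first by rewrite rmorph0; exact: ideal0.
- by move=> x y; rewrite rmorphD; exact: idealD.
- by move=> r x; rewrite rmorphM; exact: ideal_mull.
Qed.

Lemma contr_prime (P : S -> Prop) : is_prime P -> is_prime (contr phi P).
Proof.
case=> idP nP1 PM; split; first exact: contr_ideal.
  by rewrite /contr rmorph1.
by move=> a b; rewrite /contr rmorphM; exact: PM.
Qed.

Lemma ext_ideal_sub (I : R -> Prop) (P : S -> Prop) :
  is_ideal P -> subI I (contr phi P) -> subI (ext_ideal phi I) P.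
Proof.
move=> idP IP s; elim=> [|t x /IP Px|x y _ Px _ Py].
- exact: ideal0.
- exact: ideal_mull.
- exact: idealD.
Qed.

(* In a counterexample [I < P] over a maximal possible [p], take [q] minimal over
   [p] + [a] with [a] outside [p], and [Q] over [q] containing [P]. As fibres over
   [q] have no proper inclusions, [Q] is minimal over [I] + [phi a], which
   contradicts the principal ideal theorem for [I < P < Q]. *)
Theorem going_up_incomparable : noetherian R -> noetherian S -> is_local_max m ->
  (forall s, exists r, ext_ideal phi m (s - phi r)) -> going_up phi ->
  forall I P : S -> Prop, is_prime I -> is_prime P -> subI I P ->
  subI (contr phi P) (contr phi I) -> subI P I.
Proof.
move=> noethR noethS locm residue GU I0 P0 prI0 prP0 IP0 cPI0.
apply: contrapT => nPI0.
have [|p [_ [prp [I [P [prI prP IP nPI [pI Pp]]]]] maxp]] := @noetherian_max _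
  (fun p => is_prime p /\ exists I P, [/\ is_prime I, is_prime P, subI I P, ~ subI P I &
     subI p (contr phi I) /\ subI (contr phi P) p]) noethR.
  exists (contr phi P0); first by apply: contr_ideal; exact: prime_ideal.
  by split; [exact: contr_prime|exists I0, P0; split=> //; split].
have pP : subI p (contr phi P) by move=> x /pI /IP.
(* If [m] lay in [p], then [m S] would lie in [I]; as [S = phi R + m S], this would force [P] into
   [I]. *)
have [a ma npa] : exists2 a, m a & ~ p a.
  apply: contrapT => noa; apply: nPI => s Ps.
  have mI : subI (ext_ideal phi m) I.
    apply: ext_ideal_sub => [|r mr]; first exact: prime_ideal.
    by apply: pI; apply: contrapT => npr; apply: noa; exists r.
  have [r sr] := residue s; rewrite -[s](subrK (phi r)).
  have idI := prime_ideal prI; apply: (idealD idI); first exact: mI.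
  have Ir : contr phi P r.
    rewrite /contr -[phi r](subKr s).
    by apply: idealB (prime_ideal prP) Ps _; exact/IP/mI.
  exact/pI/Pp.
have prm := local_max_prime locm.
have [|q [prq paq minq]] := @minimal_prime _ (add_principal p a) m noethR prm.
  move=> x [c pc]; rewrite -[x](subrK (c * a)).
  apply: (idealD (prime_ideal prm)); first exact: (local_prime_sub locm prp).
  exact: (ideal_mull _ (prime_ideal prm)).
have idp := prime_ideal prp.
have pq : subI p q by move=> x /(add_principal_sub a) /paq.
have qa : q a by apply: paq; exact: add_principal_id.
have [Q [prQ PQ Qq]] : exists Q,
    [/\ is_prime Q, subI P Q & forall r, contr phi Q r <-> q r].
  by apply: (GU p q prp prq pq P prP) => r; split; [exact: Pp|exact: pP].
apply: nPI; apply: (@principal_ideal_theorem _ I P Q (phi a)) => //.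
- exact/Qq.
- by move=> /Pp.
- move=> Q' prQ' IQ' Q'a Q'Q.
  have qQ' : subI q (contr phi Q').
    apply: minq; first exact: contr_prime.
      move=> x [c pc]; rewrite -[x](subrK (c * a)).
      have idQ' := contr_ideal (prime_ideal prQ').
      by apply: (idealD idQ'); [exact/IQ'/pI|exact: (ideal_mull _ idQ')].
    by move=> x /Q'Q /Qq.
  apply: contrapT => nQQ'; apply: npa; apply: (maxp q) => //.
    exact: prime_ideal.
  by split=> //; exists Q', Q; split=> //; split=> // x /Qq.
Qed.

End Fibres.

(** * Submodules, chain conditions and injective modules *)

Section Submodules.
Variables (R : comNzRingType) (E : lmodType R).
Implicit Types (N V W : E -> Prop) (x y : E).

Lemma submodule0 V : submodule V -> V 0. Proof. by case. Qed.

Lemma submoduleD V x y : submodule V -> V x -> V y -> V (x + y).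
Proof. by case=> _ + _; apply. Qed.

Lemma submoduleZ V r x : submodule V -> V x -> V (r *: x).
Proof. by case=> _ _; apply. Qed.

Lemma submoduleB V x y : submodule V -> V x -> V y -> V (x - y).
Proof.
move=> sV Vx Vy; apply: submoduleD => //.
by rewrite -scaleN1r; exact: submoduleZ.
Qed.

Lemma submoduleT : submodule (fun _ : E => True). Proof. by []. Qed.

Lemma submodule_ker_scale a : submodule (fun x : E => a *: x = 0).
Proof.
split=> [|x y ax ay|r x ax]; first by rewrite scaler0.
- by rewrite scalerDr ax ay addr0.
- by rewrite scalerA mulrC -scalerA ax scaler0.
Qed.

Lemma submodule_cap V W :
  submodule V -> submodule W -> submodule (fun x => V x /\ W x).
Proof.
move=> sV sW; split=> [|x y [Vx Wx] [Vy Wy]|r x [Vx Wx]].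
- by split; exact: submodule0.
- by split; exact: submoduleD.
- by split; exact: submoduleZ.
Qed.

Lemma submodule_cyclic x : submodule (fun y => exists r, y = r *: x).
Proof.
split; first by exists 0; rewrite scale0r.
- by move=> _ _ [r ->] [s ->]; exists (r + s); rewrite scalerDl.
- by move=> r _ [s ->]; exists (r * s); rewrite scalerA.
Qed.

Lemma ann_ideal x : is_ideal (fun r => r *: x = 0).
Proof.
split; first by rewrite scale0r.
- by move=> r s rx sx; rewrite scalerDl rx sx addr0.
- by move=> r s sx; rewrite -scalerA sx scaler0.
Qed.

Lemma ideal_mod_submodule a V : is_ideal a -> submodule V -> submodule (ideal_mod a V).
Proof.
move=> ida sV; split; [exact: ideal_mod0|exact: ideal_modD|move=> r x].
elim=> [|s y as_ Vy|y z _ IHy _ IHz].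
- by rewrite scaler0; exact: ideal_mod0.
- by rewrite scalerA; apply: ideal_modZ => //; exact: ideal_mull.
- by rewrite scalerDr; exact: ideal_modD.
Qed.

Lemma ideal_mod_sub a V W : submodule W ->
  (forall r x, a r -> V x -> W (r *: x)) -> subM (ideal_mod a V) W.
Proof.
move=> sW aVW x; elim=> [|r y ar Vy|y z _ Wy _ Wz]; first exact: submodule0.
- exact: aVW.
- exact: submoduleD.
Qed.

Definition artinian W := forall V : nat -> E -> Prop,
  (forall n, submodule (V n)) -> (forall n, subM (V n) W) ->
  (forall n, subM (V n.+1) (V n)) ->
  exists k, forall n, (k <= n)%N -> subM (V k) (V n).

Lemma artinian_sub W W' : subM W' W -> artinian W -> artinian W'.
Proof.
move=> W'W artW V sV VW' dV; apply: artW => // n x /VW'; exact: W'W.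
Qed.

Lemma artinian_min W (T : (E -> Prop) -> Prop) : artinian W ->
  (exists V, [/\ submodule V, subM V W & T V]) ->
  exists V, [/\ submodule V, T V &
    forall U, submodule U -> T U -> subM U V -> subM V U].
Proof.
move=> artW exV; apply: contrapT => nomin.
have [//||u [uP u_decr]] := @dependent_choice _
  (fun V => [/\ submodule V, subM V W & T V])
  (fun V U => subM U V /\ ~ subM V U).
- move=> V [sV VW TV]; apply: contrapT => noU; apply: nomin; exists V; split=> //.
  move=> U sU TU UV; apply: contrapT => nVU; apply: noU; exists U => //.
  by split=> // x /UV /VW.
- have [||n|k kP] := artW u.
  + by move=> n; case: (uP n).
  + by move=> n; case: (uP n).
  + by case: (u_decr n).
  by case: (u_decr k) => _; apply; exact: kP.
Qed.

Lemma descending_submodules (V : nat -> E -> Prop) k n :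
  (forall n, subM (V n.+1) (V n)) -> (k <= n)%N -> subM (V n) (V k).
Proof.
move=> dV /subnK <-; elim: (n - k)%N => [|i IHi] x //.
by rewrite addSn => /dV /IHi.
Qed.

(* The dual of Hilbert's basis theorem: a submodule [V] of [W] is determined,
   among the submodules containing it, by its "leading submodules"
   [a ^+ n (V :&: ker a ^+ n.+1)] of [ker a], which decrease with [n]. *)
Lemma artinian_extension W a : submodule W ->
  (forall x, W x -> exists n, a ^+ n *: x = 0) ->
  artinian (fun x => W x /\ a *: x = 0) -> artinian W.
Proof.
move=> sW nilW artK V sV VW dV.
pose L n j y := exists x, [/\ V j x, a ^+ n.+1 *: x = 0 & y = a ^+ n *: x].
have sL n j : submodule (L n j).
  split.
  - by exists 0; rewrite !scaler0; split=> //; exact: submodule0.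
  - move=> _ _ [x [Vx ax ->]] [y [Vy ay ->]]; exists (x + y).
    by split; [exact: submoduleD|rewrite scalerDr ax ay addr0|rewrite scalerDr].
  - move=> r _ [x [Vx ax ->]]; exists (r *: x).
    split; [exact: submoduleZ|by rewrite scalerA mulrC -scalerA ax scaler0|].
    by rewrite !scalerA mulrC.
have LK n j : subM (L n j) (fun x => W x /\ a *: x = 0).
  move=> _ [x [Vx ax ->]]; split; last by rewrite scalerA -exprS.
  by apply: submoduleZ => //; exact: (VW j).
have dLn n j : subM (L n.+1 j) (L n j).
  move=> _ [x [Vx ax ->]]; exists (a *: x); split; first exact: submoduleZ.
    by rewrite scalerA -exprSr.
  by rewrite scalerA -exprSr.
have dLj n j : subM (L n j.+1) (L n j).
  by move=> _ [x [Vx ax ->]]; exists x; split=> //; exact: dV.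
(* The diagonal chain [L n n] stabilizes at some [k], which handles all [n >= k] at once. The
   finitely many rows [n < k] stabilize separately, so one bound [K] serves every row. *)
have [n|n|n x /dLn /dLj //|k kP] := artK (fun n => L n n); [exact: sL|exact: LK|].
have /choice[kn knP] : forall n, exists k, forall j, (k <= j)%N -> subM (L n k) (L n j).
  by move=> n; apply: artK; [exact: sL|exact: LK|exact: dLj].
pose K := maxn k (\max_(n < k) kn n).
have stabL n j : (K <= j)%N -> subM (L n K) (L n j).
  move=> Kj; have [nk|kn_] := ltnP n k.
    have knK : (kn n <= K)%N.
      by rewrite leq_max (leq_bigmax (Ordinal nk)) orbT.
    move=> y /(descending_submodules (dLj n) knK); apply: knP.
    exact: leq_trans Kj.
  have kK : (k <= K)%N by rewrite leq_maxl.
  move=> y /(descending_submodules (dLj n) kK).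
  move=> /(descending_submodules (fun i => dLn i k) kn_).
  move=> /(kP (maxn n j) (leq_trans kn_ (leq_maxl _ _))).
  move=> /(descending_submodules (dLj _) (leq_maxr n j)).
  exact: (descending_submodules (fun i => dLn i j) (leq_maxl n j)).
exists K => j Kj x Vx; have [n] := nilW x (VW _ _ Vx).
(* Induction on the power of [a] killing [x]: some [y] in [V j] has the same leading term
   [a ^+ n *: x], so [x - y] is killed by [a ^+ n]. *)
elim: n x Vx => [|n IHn] x Vx ax.
  by move: ax; rewrite expr0 scale1r => ->; exact: submodule0.
have [y [Vy ay axy]] : L n j (a ^+ n *: x) by apply: stabL => //; exists x.
rewrite -[x](subrK y); apply: submoduleD => //; apply: IHn.
  by apply: submoduleB => //; exact: (descending_submodules dV Kj).
by rewrite scalerBr axy subrr.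
Qed.

End Submodules.

Section Linear.
Variables (R : comNzRingType) (A B : lmodType R).

Definition is_linear (f : A -> B) := forall a x y, f (a *: x + y) = a *: f x + f y.

Lemma is_linear0 (f : A -> B) : is_linear f -> f 0 = 0.
Proof. by move=> /(_ (-1) 0 0); rewrite !scaleN1r oppr0 addr0 addNr. Qed.

Lemma is_linearZ (f : A -> B) a x : is_linear f -> f (a *: x) = a *: f x.
Proof. by move=> linf; rewrite -[a *: x]addr0 linf is_linear0 ?addr0. Qed.

Lemma is_linearD (f : A -> B) x y : is_linear f -> f (x + y) = f x + f y.
Proof. by move=> linf; rewrite -[x]scale1r linf !scale1r. Qed.

End Linear.

Lemma is_linear_scale (R : comNzRingType) (A : lmodType R) a :
  is_linear (fun x : A => a *: x).
Proof. by move=> b x y; rewrite scalerDr !scalerA mulrC. Qed.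

Section SubmoduleType.
Variables (R : comNzRingType) (B : lmodType R) (X : B -> Prop).
Implicit Type sX : submodule X.

(** Turns a submodule given by a predicate into a module type, because [injective_module] quantifies
    over module types. The proof [sX] is a parameter so that the instances can depend on it. *)
Definition submodule_pred sX : {pred B} := fun x => `[<X x>].

Fact submodule_pred_closed sX : submod_closed (submodule_pred sX).
Proof.
split; first by apply/asboolP; exact: submodule0.
move=> a x y /asboolP Xx /asboolP Xy; apply/asboolP.
by apply: submoduleD => //; exact: submoduleZ.
Qed.

HB.instance Definition _ sX :=
  GRing.isSubmodClosed.Build R B (submodule_pred sX) (submodule_pred_closed sX).

Record submodule_type sX := SubmoduleType {
  submodule_val : B;
  _ : submodule_val \in submodule_pred sX }.

HB.instance Definition _ sX := [isSub for @submodule_val sX].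
HB.instance Definition _ sX := [Choice of submodule_type sX by <:].
HB.instance Definition _ sX := [SubChoice_isSubLmodule of submodule_type sX by <:].

End SubmoduleType.

(** * Extension and factorization of maps into an injective module *)

Section Injective.
Variables (R : comNzRingType) (m : R -> Prop) (E : lmodType R).
Hypothesis injE : injective_module E.

Lemma linear_extension (B : lmodType R) (X : B -> Prop) (g : B -> E) :
  submodule X -> (forall a x y, X x -> X y -> g (a *: x + y) = a *: g x + g y) ->
  exists2 h, is_linear h & forall x, X x -> h x = g x.
Proof.
move=> sX ling.
have [a x y|a [x Xx] [y Xy]||h [linh hE]] := injE (A := submodule_type sX) (B := B)
  (f := val) (g := g \o val).
- by rewrite linearP.
- by rewrite /comp linearP ling //; exact/asboolP.
- exact: val_inj.
- exists h => // x Xx; have Xx' : x \in submodule_pred sX by exact/asboolP.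
  by rewrite (hE (SubmoduleType Xx')).
Qed.

Hypothesis locm : is_local_max m.

(** If [d *: y] is in [V], then [d] is not a unit, so [d] lies in [m] and kills [e0]. Hence
    [v + c *: y |-> c *: e0] is well defined on [V + R y], and injectivity extends it. *)
Lemma separating_hom (B : lmodType R) (V : B -> Prop) y (e0 : E) :
  (forall r, m r -> r *: e0 = 0) -> submodule V -> ~ V y ->
  exists2 h : B -> E, is_linear h & (forall x, V x -> h x = 0) /\ h y = e0.
Proof.
move=> me0 sV nVy; pose X b := exists c, V (b - c *: y).
have mV d : V (d *: y) -> d *: e0 = 0.
  move=> Vdy; apply: me0; apply: contrapT => nmd; apply: nVy.
  have [s sd1] := local_unit locm nmd.
  by rewrite -[y]scale1r -sd1 -scalerA; exact: submoduleZ.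
(* The coefficient [c b] is determined only up to scalars killing [e0]; outside [X] it is the
   irrelevant default 0. *)
have /choice[c cP] : forall b, exists c, X b -> V (b - c *: y).
  by move=> b; have [[c Vc]|nX] := pselect (X b); [exists c|exists 0].
have cE b d : V (b - d *: y) -> c b *: e0 = d *: e0.
  move=> Vd; have Vc : V (b - c b *: y) by apply: cP; exists d.
  apply/eqP; rewrite -subr_eq0 -scalerBl; apply/eqP; apply: mV.
  have -> : (c b - d) *: y = (b - d *: y) - (b - c b *: y).
    by rewrite opprB [RHS]addrC addrA subrK -scalerBl.
  exact: submoduleB.
have addX a u v : X u -> X v -> V (a *: u + v - (a * c u + c v) *: y).
  move=> /cP Vu /cP Vv.
  have -> : a *: u + v - (a * c u + c v) *: y = a *: (u - c u *: y) + (v - c v *: y).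
    by rewrite scalerBr scalerDl -scalerA opprD addrACA.
  by apply: submoduleD => //; exact: submoduleZ.
have [||h linh hE] := @linear_extension B X (fun b => c b *: e0).
- split.
  + by exists 0; rewrite scale0r subr0; exact: submodule0.
  + move=> u v Xu Xv; exists (1 * c u + c v); rewrite -[u in u + v]scale1r.
    exact: addX.
  + move=> a u Xu; exists (a * c u + c 0); rewrite -[a *: u]addr0.
    by apply: addX => //; exists 0; rewrite scale0r subr0; exact: submodule0.
- by move=> a u v Xu Xv; rewrite (cE _ _ (addX a u v Xu Xv)) scalerDl scalerA.
exists h => //; split=> [x Vx|].
  have Vx0 : V (x - 0 *: y) by rewrite scale0r subr0.
  by rewrite hE; [rewrite (cE _ _ Vx0) scale0r|exists 0].
have Vy1 : V (y - 1 *: y) by rewrite scale1r subrr; exact: submodule0.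
by rewrite hE; [rewrite (cE _ _ Vy1) scale1r|exists 1].
Qed.

Variables (I : Type) (g : I -> E -> E).
Hypothesis ling : forall i, is_linear (g i).

(** The left ideal of [End E] generated by the [g i] with [i] in the list. *)
Inductive combination : seq I -> (E -> E) -> Prop :=
| combination_nil : combination [::] (fun=> 0)
| combination_cons i l h c : is_linear h -> combination l c ->
    combination (i :: l) (fun x => h (g i x) + c x).

Fixpoint common_ker (l : seq I) (x : E) : Prop :=
  if l is i :: l' then g i x = 0 /\ common_ker l' x else True.

Lemma combination_linear l c : combination l c -> is_linear c.
Proof.
elim=> {l c} [|i l h c linh _ linc] a x y; first by rewrite scaler0 addr0.
by rewrite linc ling linh scalerDr addrACA.
Qed.

(** Induction on [l]: on the part of [W] killed by [g i], [f] agrees with a combination [c] of the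
    remaining maps. So [f - c] factors on [W] through [g i], and the induced map on [g i (W)]
    extends to [E] by injectivity. *)
Lemma factor_combination l W f : submodule W -> is_linear f ->
  (forall x, W x -> common_ker l x -> f x = 0) ->
  exists2 c, combination l c & forall x, W x -> f x = c x.
Proof.
elim: l W => [|i l IHl] W sW linf kerf.
  by exists (fun=> 0); [exact: combination_nil|move=> x Wx; exact: kerf].
have [|x [Wx gx] kx|c cc fc] := IHl (fun x => W x /\ g i x = 0) _ linf.
- apply: submodule_cap => //; split; first exact: is_linear0.
  + by move=> x y gx gy; rewrite is_linearD // gx gy addr0.
  + by move=> r x gx; rewrite is_linearZ // gx scaler0.
- exact: kerf.
have linc := combination_linear cc.
pose F x := f x - c x.
have linF : is_linear F.
  by move=> a x y; rewrite /F linf linc scalerBr opprD addrACA.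
have F0 x : W x -> g i x = 0 -> F x = 0 by move=> Wx gx; rewrite /F fc // subrr.
(* [p] picks a preimage under [g i] in [W]; [F \o p] is then the map induced by [F] on [g i (W)],
   independent of the choice by [F0]. *)
have /choice[p pP] : forall z, exists x, (exists2 y, W y & z = g i y) -> W x /\ z = g i x.
  move=> z; have [[x Wx ->]|nz] := pselect (exists2 y, W y & z = g i y).
    by exists x.
  by exists 0.
have pE x : W x -> F (p (g i x)) = F x.
  move=> Wx; have [|Wp gp] := pP (g i x); first by exists x.
  apply/esym/eqP; rewrite -subr_eq0 addrC -scaleN1r -linF; apply/eqP/F0.
    by apply: submoduleD => //; exact: submoduleZ.
  by rewrite ling -gp scaleN1r addNr.
have [||h linh hE] := @linear_extension E (fun z => exists2 y, W y & z = g i y) (F \o p).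
- split.
  + by exists 0; [exact: submodule0|rewrite is_linear0].
  + move=> _ _ [x Wx ->] [y Wy ->]; exists (x + y); first exact: submoduleD.
    by rewrite is_linearD.
  + move=> r _ [x Wx ->]; exists (r *: x); first exact: submoduleZ.
    by rewrite is_linearZ.
- move=> a _ _ [x Wx ->] [y Wy ->]; rewrite /= -ling !pE //.
  by apply: submoduleD => //; exact: submoduleZ.
exists (fun x => h (g i x) + c x); first exact: combination_cons.
by move=> x Wx; rewrite hE; [rewrite /= pE // subrK|exists x].
Qed.

End Injective.

(** * Powers of an ideal and extension along [phi] *)

Section IdealPowers.
Variables (R S : comNzRingType) (phi : {rmorphism R -> S}) (m : R -> Prop).
Hypothesis idm : is_ideal m.

Lemma ideal_pow_ideal n : is_ideal (ideal_pow m n).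
Proof.
case: n => [|n] /=; first by split.
split; [exact: prod_ideal0|exact: prod_idealD|move=> r x].
elim=> [|a b ma mb|y z _ IHy _ IHz].
- by rewrite mulr0; exact: prod_ideal0.
- by rewrite mulrA; apply: prod_idealM => //; exact: ideal_mull.
- by rewrite mulrDr; exact: prod_idealD.
Qed.

Lemma ideal_pow_anti k n : (k <= n)%N -> subI (ideal_pow m n) (ideal_pow m k).
Proof.
move=> /subnK <-; elim: (n - k)%N => [|i IHi] x //; rewrite addSn => /= mx.
apply: IHi; elim: mx => [|a b _ mb|y z _ my _ mz].
- exact: (ideal0 (ideal_pow_ideal _)).
- exact: (ideal_mull _ (ideal_pow_ideal _)).
- exact: (idealD (ideal_pow_ideal _)).
Qed.

Lemma ext_ideal_ideal (I : R -> Prop) : is_ideal (ext_ideal phi I).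
Proof.
split; [exact: ext_ideal0|exact: ext_idealD|move=> s x].
elim=> [|t y Iy|y z _ IHy _ IHz].
- by rewrite mulr0; exact: ext_ideal0.
- by rewrite mulrA; exact: ext_idealM.
- by rewrite mulrDr; exact: ext_idealD.
Qed.

Lemma ext_ideal_mono (I J : R -> Prop) :
  subI I J -> subI (ext_ideal phi I) (ext_ideal phi J).
Proof.
move=> IJ s; elim=> [|t y Iy|y z _ Jy _ Jz]; first exact: ext_ideal0.
- by apply: ext_idealM; exact: IJ.
- exact: ext_idealD.
Qed.

Lemma ext_ideal_image (I : R -> Prop) r : I r -> ext_ideal phi I (phi r).
Proof. by move=> Ir; rewrite -[phi r]mul1r; exact: ext_idealM. Qed.

End IdealPowers.

(** * The injective hull of the residue field *)

Section InjectiveHull.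
Variables (R : comNzRingType) (m : R -> Prop) (E : lmodType R) (e0 : E).
Hypotheses (noethR : noetherian R) (locm : is_local_max m).
Hypothesis ann_e0 : forall r, r *: e0 = 0 <-> m r.
Hypothesis essential_e0 : forall V : E -> Prop, submodule V -> nonzeroM V ->
  exists r, V (r *: e0) /\ r *: e0 <> 0.

Let idm : is_ideal m := prime_ideal (local_max_prime locm).

Definition torsion n (x : E) := forall t, ideal_pow m n t -> t *: x = 0.

Lemma torsion_submodule n : submodule (torsion n).
Proof.
split=> [t _|x y mx my t mt|r x mx t mt]; first by rewrite scaler0.
- by rewrite scalerDr mx // my // addr0.
- by rewrite scalerA mulrC -scalerA mx // scaler0.
Qed.

Lemma torsion_mono k n x : (k <= n)%N -> torsion k x -> torsion n x.
Proof. by move=> kn mx t /(ideal_pow_anti idm kn); exact: mx. Qed.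

(** By essentiality some nonzero [t *: x] lies in [R e0]; since [m] kills [x], [t] is a unit. *)
Lemma socle_e0 (x : E) : (forall a, m a -> a *: x = 0) -> exists c, x = c *: e0.
Proof.
move=> mx; have [->|nx] := pselect (x = 0); first by exists 0; rewrite scale0r.
have [|r [[t rt] nr]] := essential_e0 (submodule_cyclic x).
  by exists x; split=> //; exists 1; rewrite scale1r.
have nmt : ~ m t by move=> /mx tx; apply: nr; rewrite rt.
have [s st1] := local_unit locm nmt.
by exists (s * r); rewrite -scalerA rt scalerA st1 scale1r.
Qed.

(** The annihilators of [a ^+ n *: x] stabilize at some [k]. Were [a ^+ k *: x] nonzero, it would
    have a nonzero multiple in [R e0]; this is killed by [a], hence already zero by stability. *)
Lemma nilpotent_max a (x : E) : m a -> exists n, a ^+ n *: x = 0.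
Proof.
move=> ma; have [||k kP] := noethR (I := fun n r => r *: (a ^+ n *: x) = 0).
- by move=> n; exact: ann_ideal.
- by move=> n r rx; rewrite exprS -scalerA scalerA mulrC -scalerA rx scaler0.
exists k; apply: contrapT => nx.
have [|r [[t rt] nr]] := essential_e0 (submodule_cyclic (a ^+ k *: x)).
  by exists (a ^+ k *: x); split=> //; exists 1; rewrite scale1r.
apply: nr; rewrite rt; apply: (kP k.+1) => //.
rewrite exprS -scalerA scalerA mulrC -scalerA -rt scalerA mulrC -scalerA.
by have /ann_e0 -> := ma; rewrite scaler0.
Qed.

(** Take a counterexample [y] with maximal annihilator. If [a *: y] were also one, for [a] in [m],
    it would have the same annihilator as [y], and nilpotency of [a] on [y] would give [y = 0]. So
    each generator of [m] sends [y] to a torsion element, and [y] is torsion. *)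
Lemma torsion_exists (x : E) : exists n, torsion n x.
Proof.
apply: contrapT => nx.
have [|I [_ [y ny IE] maxI]] := @noetherian_max R
  (fun I => exists2 y, ~ (exists n, torsion n y) & I = fun r => r *: y = 0) noethR.
  by exists (fun r => r *: x = 0); [exact: ann_ideal|exists x].
have may a : m a -> exists n, torsion n (a *: y).
  move=> ma; apply: contrapT => nay; apply: ny.
  have Iay r : r *: (a *: y) = 0 -> r *: y = 0.
    move=> ray; have : I r; last by rewrite IE.
    apply: (maxI (fun r => r *: (a *: y) = 0)) => //; [exact: ann_ideal|by exists (a *: y)|].
    by rewrite IE => s sy; rewrite scalerA mulrC -scalerA sy scaler0.
  have [n] := nilpotent_max y ma; elim: n => [|n IHn].
    by rewrite expr0 scale1r => ->; exists 0%N => t _; rewrite scaler0.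
  by rewrite exprSr -scalerA => /Iay /IHn.
have [l lm ml] := noetherian_fg noethR idm.
have [n nP] : exists n, forall a, a \in l -> torsion n (a *: y).
  elim: l lm {ml} => [|a l IHl] lm; first by exists 0%N.
  have [|n nP] := IHl; first by move=> b bl; apply: lm; rewrite inE bl orbT.
  have [k kP] := may a (lm a (mem_head _ _)).
  exists (maxn k n) => b; rewrite inE => /predU1P[->|bl].
    by apply: torsion_mono kP; rewrite leq_maxl.
  by apply: torsion_mono (nP b bl); rewrite leq_maxr.
apply: ny; exists n.+1 => t /=; elim=> [|a b ma mb|u v _ uy _ vy].
- by rewrite scale0r.
- rewrite mulrC -scalerA.
  apply: (lspan_sub (I := fun a => b *: (a *: y) = 0) _ _ (ml a ma)).
    split=> [|c d cy dy|c d dy]; first by rewrite scale0r scaler0.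
      by rewrite scalerDl scalerDr cy dy addr0.
    by rewrite -scalerA scalerA mulrC -scalerA dy scaler0.
  by move=> c cl; exact: nP.
- by rewrite scalerDl uy vy addr0.
Qed.

Lemma artinian_socle : artinian (fun x : E => forall a, m a -> a *: x = 0).
Proof.
move=> V sV Vsoc dV.
have [[k V0]|nV0] := pselect (exists k, subM (V k) (fun x => x = 0)).
  by exists k => n _ x /V0 ->; exact: submodule0.
exists 0%N => n _ x Vx; have [c ->] := socle_e0 (Vsoc _ _ Vx).
apply: submoduleZ => //; have [y [Vy ny]] : nonzeroM (V n).
  apply: contrapT => nn; apply: nV0; exists n => y Vy; apply: contrapT => ny.
  by apply: nn; exists y.
have [d yE] := socle_e0 (Vsoc _ _ Vy).
have nmd : ~ m d by move=> /ann_e0 de0; apply: ny; rewrite yE.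
have [s sd1] := local_unit locm nmd.
by rewrite -[e0]scale1r -sd1 -scalerA -yE; exact: submoduleZ.
Qed.

(** Imposing the generators of [m] one at a time cuts [E] down to its socle; [artinian_extension]
    climbs back. *)
Lemma artinian_hull : artinian (fun _ : E => True).
Proof.
have [l lm ml] := noetherian_fg noethR idm.
have ext : forall (l : seq R) W, (forall a, a \in l -> m a) -> submodule W ->
    artinian (fun x : E => W x /\ forall a, a \in l -> a *: x = 0) -> artinian W.
  elim=> [|a l' IHl] W lm' sW artW; first by apply: artinian_sub artW => x Wx; split.
  apply: (@artinian_extension _ _ W a) => //.
    by move=> x _; apply: nilpotent_max; apply: lm'; exact: mem_head.
  apply: IHl.
  - by move=> b bl; apply: lm'; rewrite inE bl orbT.
  - by apply: submodule_cap => //; exact: submodule_ker_scale.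
  - apply: artinian_sub artW => x [[Wx ax] lx]; split=> // b.
    by rewrite inE => /predU1P[->|/lx].
apply: (ext l) => //.
apply: artinian_sub artinian_socle => x [_ lx] a /ml.
exact: (lspan_sub (ann_ideal x) lx).
Qed.

Hypothesis injE : injective_module E.

(** If [r] is outside [m^n], some [h : R -> E] kills [m^n] and sends [r] to [e0]; then [h 1] is
    torsion of level [n] but not killed by [r]. *)
Lemma ann_torsion n r : (forall x, torsion n x -> r *: x = 0) -> ideal_pow m n r.
Proof.
move=> nr; apply: contrapT => npr.
have me0 a : m a -> a *: e0 = 0 by move=> /ann_e0.
have sm : submodule (ideal_pow m n : R^o -> Prop) by exact: ideal_pow_ideal.
have [h linh [mh he0]] := separating_hom injE locm me0 sm npr.
have hE (t : R) : h (t : R^o) = t *: h (1 : R^o).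
  by rewrite -is_linearZ // /GRing.scale /= mulr1.
have ne0 : e0 <> 0.
  have [_ nm1 _] := locm.
  by move=> e00; apply: nm1; apply/ann_e0; rewrite e00 scaler0.
by apply: ne0; rewrite -he0 hE; apply: nr => t mt; rewrite -hE mh.
Qed.

(** Once [h] is multiplication by [r] on level [n], the difference [f] vanishes on the common kernel
    of generators [b] of [m^n]. On level [n.+1] it is thus a sum of maps [h' (b *: x)]; there
    [b *: x] is in the socle [R e0], on which [h'] is multiplication by a scalar. *)
Lemma endo_torsion (h : E -> E) n : is_linear h ->
  exists r, forall x, torsion n x -> h x = r *: x.
Proof.
move=> linh; elim: n => [|n [r rP]].
  exists 0 => x /(_ 1 I); rewrite scale1r => ->.
  by rewrite scaler0 is_linear0.
have [l lmn mnl] := noetherian_fg noethR (ideal_pow_ideal idm n).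
pose f x := h x - r *: x.
have linf : is_linear f.
  by move=> a x y; rewrite /f linh (is_linear_scale r) scalerBr opprD addrACA.
have [x mx kx|c cc fc] := @factor_combination R E injE R *:%R
    (@is_linear_scale R E) l _ f (torsion_submodule n.+1) linf.
  rewrite /f rP ?subrr // => t /mnl.
  have lx a : a \in l -> a *: x = 0.
    elim: l kx {lmn mnl} => //= b l IHl [bx lx]; rewrite inE => /predU1P[->//|].
    exact: IHl.
  exact: (lspan_sub (ann_ideal x) lx).
have [s sP] : exists s, forall x, torsion n.+1 x -> c x = s *: x.
  elim: cc lmn {fc mnl} => [|b l' h' c' linh' _ IHc] lmn.
    by exists 0 => x _; rewrite scale0r.
  have [|s sP] := IHc; first by move=> a al; apply: lmn; rewrite inE al orbT.
  have [u uP] : exists u, h' e0 = u *: e0.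
    apply: socle_e0 => a /ann_e0 ae0.
    by rewrite -is_linearZ // ae0 is_linear0.
  exists (u * b + s) => x mx; rewrite sP // scalerDl; congr (_ + _).
  have [a ma|d bx] := @socle_e0 (b *: x).
    rewrite scalerA; apply: mx; apply: prod_idealM => //.
    by apply: lmn; exact: mem_head.
  by rewrite -scalerA bx is_linearZ // uP !scalerA mulrC.
exists (r + s) => x mx; rewrite scalerDl -sP // -fc // /f addrC subrK //.
Qed.

(** * Matlis duality over the completion *)

Section Completion.
Variables (S : comNzRingType) (phi : {rmorphism R -> S}).
Hypothesis complS : is_completion phi m.

Local Notation mS n := (ext_ideal phi (ideal_pow m n)).

Lemma completion_action : exists act : S -> E -> E, forall s x n r,
  torsion n x -> mS n (s - phi r) -> act s x = r *: x.
Proof.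
have [approx inj _ _] := complS.
suff /choice[act actP] : forall s, exists f : E -> E, forall x n r,
  torsion n x -> mS n (s - phi r) -> f x = r *: x by exists act.
move=> s; suff /choice : forall x, exists y, forall n r,
  torsion n x -> mS n (s - phi r) -> y = r *: x by case=> f; exists f.
move=> x; have [n0 x0] := torsion_exists x; have [r0 sr0] := approx n0 s.
exists (r0 *: x) => n r xn sr.
(* With [k] the smaller of [n] and [n0], both approximations of [s] hold modulo [m^k S] and [m^k]
   kills [x], so [r] and [r0] act alike on [x]. *)
suff [k kx [sr0k srk]] : exists2 k, torsion k x & mS k (s - phi r0) /\ mS k (s - phi r).
  apply/eqP; rewrite -subr_eq0 -scalerBl; apply/eqP/kx/inj.
  have -> : phi (r0 - r) = (s - phi r) - (s - phi r0) by rewrite rmorphB; ring.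
  by apply: idealB => //; exact: ext_ideal_ideal.
have [nn0|/ltnW n0n] := leqP n n0; [exists n|exists n0] => //; split=> //.
  exact: ext_ideal_mono (ideal_pow_anti idm nn0) _ sr0.
exact: ext_ideal_mono (ideal_pow_anti idm n0n) _ sr.
Qed.

Variable act : S -> E -> E.
Hypothesis actE : forall s x n r, torsion n x -> mS n (s - phi r) -> act s x = r *: x.

Lemma act_approx s x n : torsion n x ->
  exists2 r, mS n (s - phi r) & act s x = r *: x.
Proof.
move=> xn; have [/(_ n s)[r sr] _ _ _] := complS.
by exists r => //; exact: actE xn sr.
Qed.

Lemma act_scale s x : exists r, act s x = r *: x.
Proof. by have [n /(act_approx s)[r _ ->]] := torsion_exists x; exists r. Qed.

Lemma act_submodule (V : E -> Prop) s x : submodule V -> V x -> V (act s x).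
Proof. by move=> sV Vx; have [r ->] := act_scale s x; exact: submoduleZ. Qed.

Lemma act_linear s : is_linear (act s).
Proof.
move=> a x y; have [[n xn] [k yk]] := (torsion_exists x, torsion_exists y).
have {}xn := torsion_mono (leq_maxl n k) xn.
have {}yk := torsion_mono (leq_maxr n k) yk.
have [r sr ->] := act_approx s xn.
rewrite (actE yk sr) (actE (r := r) _ sr) ?is_linear_scale //.
have sT := torsion_submodule (maxn n k).
by apply: (submoduleD sT) => //; exact: (submoduleZ _ sT).
Qed.

Lemma act_phi r x : act (phi r) x = r *: x.
Proof.
have [n xn] := torsion_exists x; apply: (actE xn).
by rewrite subrr; exact: ext_ideal0.
Qed.

Lemma act0 x : act 0 x = 0.
Proof. by rewrite -(rmorph0 phi) act_phi scale0r. Qed.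

Lemma act1 x : act 1 x = x.
Proof. by rewrite -(rmorph1 phi) act_phi scale1r. Qed.

Lemma actD s t x : act (s + t) x = act s x + act t x.
Proof.
have [n xn] := torsion_exists x.
have [[r sr ->] [q tq ->]] := (act_approx s xn, act_approx t xn).
rewrite -scalerDl; apply: (actE xn).
have -> : s + t - phi (r + q) = (s - phi r) + (t - phi q) by rewrite rmorphD; ring.
exact: ext_idealD.
Qed.

Lemma actM s t x : act (s * t) x = act s (act t x).
Proof.
have [n xn] := torsion_exists x.
have [[r sr _] [q tq ->]] := (act_approx s xn, act_approx t xn).
rewrite (is_linearZ _ _ (act_linear s)) (actE xn sr) scalerA [q * r]mulrC.
apply: (actE xn).
have -> : s * t - phi (r * q) = t * (s - phi r) + phi r * (t - phi q).
  by rewrite rmorphM; ring.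
have idS := ext_ideal_ideal phi (ideal_pow m n).
by apply: idealD => //; exact: ideal_mull.
Qed.

Lemma annS_act (V : E -> Prop) s : annS phi m V s <-> forall x, V x -> act s x = 0.
Proof.
split=> [sV x Vx|sV x Vx n r xn sr]; last by rewrite -(actE xn sr); exact: sV.
by have [n xn] := torsion_exists x; have [r sr ->] := act_approx s xn; exact: sV sr.
Qed.

Lemma annS_ideal (V : E -> Prop) : is_ideal (annS phi m V).
Proof.
split.
- by apply/annS_act => x _; exact: act0.
- move=> s t /annS_act sV0 /annS_act tV0; apply/annS_act => x Vx.
  by rewrite actD sV0 // tV0 // addr0.
- move=> s t /annS_act tV0; apply/annS_act => x Vx.
  by rewrite actM tV0 // is_linear0 //; exact: act_linear.
Qed.

(** Modulo [m^n S], [s] is some [phi r] with [r] killing level [n], so [r] is in [m^n] by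
    [ann_torsion]. Separatedness concludes. *)
Lemma act_faithful s : (forall x, act s x = 0) -> s = 0.
Proof.
move=> s0; have [approx _ sep _] := complS.
apply: sep => n; have [r sr] := approx n s.
rewrite -[s](subrK (phi r)); apply: ext_idealD => //; apply: ext_ideal_image.
by apply: ann_torsion => x xn; rewrite -(actE xn sr).
Qed.

(** The scalars [r n] from [endo_torsion] form a Cauchy sequence, because [r n.+1 - r n] kills level
    [n] and so lies in [m^n]; [s] is its limit. *)
Lemma endo_act (h : E -> E) : is_linear h -> exists s, forall x, h x = act s x.
Proof.
move=> linh; have [_ _ _ lim] := complS.
have /choice[r rP] : forall n, exists r, forall x, torsion n x -> h x = r *: x.
  by move=> n; exact: endo_torsion.
have [n|s sP] := lim (phi \o r).
  rewrite /= -rmorphB; apply: ext_ideal_image; apply: ann_torsion => x xn.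
  by rewrite scalerBl -!rP ?subrr //; exact: torsion_mono xn.
by exists s => x; have [n xn] := torsion_exists x; rewrite (actE xn (sP n)) (rP n).
Qed.

Definition ann_module (J : S -> Prop) (x : E) := forall s, J s -> act s x = 0.

Lemma ann_module_submodule J : submodule (ann_module J).
Proof.
split=> [s _|x y Jx Jy s Js|r x Jx s Js]; have lins := act_linear s.
- by rewrite is_linear0.
- by rewrite is_linearD // Jx // Jy // addr0.
- by rewrite is_linearZ // Jx // scaler0.
Qed.

(** A point outside [V] is moved to [e0] by an endomorphism killing [V], and that endomorphism is
    the action of an element of [Ann_S V]. *)
Lemma ann_module_annS (V : E -> Prop) x :
  submodule V -> ann_module (annS phi m V) x -> V x.
Proof.
move=> sV Vx; apply: contrapT => nVx.
have me0 a : m a -> a *: e0 = 0 by move=> /ann_e0.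
have [h linh [hV hx]] := separating_hom injE locm me0 sV nVx.
have [s sP] := endo_act linh.
have [_ nm1 _] := locm; apply: nm1; apply/ann_e0.
by rewrite -hx sP Vx ?scaler0 //; apply/annS_act => y Vy; rewrite -sP hV.
Qed.

(** As [E] is Artinian, finitely many elements of [J] already cut out [Ann_E J]. An [f] killing it
    is a combination of their actions with coefficients in [End E = S], so [f] is in [J] by
    faithfulness. *)
Lemma annS_ann_module J : is_ideal J -> subI (annS phi m (ann_module J)) J.
Proof.
move=> idJ f /annS_act fJ.
pose T V := exists l : seq S, (forall s, s \in l -> J s) /\
  V = (fun x => forall s, s \in l -> act s x = 0).
have sker (l : seq S) : submodule (fun x => forall s, s \in l -> act s x = 0).
  exact: (ann_module_submodule (fun s => s \in l)).
have [|V [sV [l [lJ VE]] minV]] := @artinian_min _ _ _ T artinian_hull.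
  by exists (fun x => forall s, s \in [::] -> act s x = 0); split=> //; exists [::].
have VJ x : V x -> ann_module J x.
  move=> Vx s Js.
  pose U x := forall t, t \in s :: l -> act t x = 0.
  suff /(_ s (mem_head _ _)) : U x by [].
  apply: (minV U) => //; first exact: sker.
    by exists (s :: l); split=> // t; rewrite inE => /predU1P[->|/lJ].
  by move=> y Uy; rewrite VE => t tl; apply: Uy; rewrite inE tl orbT.
have [x _ kx|c cc fc] := @factor_combination R E injE S act act_linear l _ (act f)
   (@submoduleT R E) (act_linear f).
  apply/fJ/VJ; rewrite VE.
  elim: l kx {lJ VE} => //= t l IHl [tx lx] s; rewrite inE => /predU1P[->//|].
  exact: IHl.
have [s Js sP] : exists2 s, J s & forall x, c x = act s x.
  elim: cc lJ {fc VE} => [|t l' h c' linh _ IHc] lJ.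
    by exists 0; [exact: ideal0|move=> x; rewrite act0].
  have [|s Js sP] := IHc; first by move=> u ul; apply: lJ; rewrite inE ul orbT.
  have [u uP] := endo_act linh.
  exists (u * t + s); last by move=> x; rewrite uP sP actD actM.
  apply: idealD => //; apply: ideal_mull => //; apply: lJ; exact: mem_head.
suff -> : f = s by [].
apply/eqP; rewrite -subr_eq0; apply/eqP/act_faithful => x.
have lin_x : act (f - s) x + act s x = act f x by rewrite -actD subrK.
by apply: (addIr (act s x)); rewrite lin_x add0r fc // sP.
Qed.

Lemma completion_noetherian : noetherian S.
Proof.
move=> I idI incI.
have [||n|k kP] := artinian_hull (V := fun n => ann_module (I n)).
- by move=> n; exact: ann_module_submodule.
- by [].
- by move=> x Ix s /incI; exact: Ix.
exists k => n kn s Is; apply: annS_ann_module => //.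
by apply/annS_act => x /(kP n kn); exact.
Qed.

(** * Divisible submodules *)

Section Divisibility.
Implicit Type V : E -> Prop.
Variable F : (R -> Prop) -> Prop.
Hypothesis gabF : gabriel_topology F.

Let idF a : F a -> is_ideal a.
Proof. by case: gabF => _ + _ _ _; apply. Qed.

Let upF a b : F a -> is_ideal b -> subI a b -> F b.
Proof. by case: gabF => _ _ + _ _; apply. Qed.

(* [a N = N] iff [(Ann_S N : a S) = Ann_S N], by the double annihilator property. *)
Lemma F_divisible_ann V : submodule V ->
  (forall a, F a -> forall s,
    (forall r, a r -> annS phi m V (s * phi r)) -> annS phi m V s) ->
  F_divisible F V.
Proof.
move=> sV divV a Fa x; split=> [Vx|]; last first.
  by apply: ideal_mod_sub => // r y _; exact: submoduleZ.
apply: ann_module_annS; first exact: ideal_mod_submodule (idF Fa) sV.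
move=> s /annS_act saV; suff /annS_act : annS phi m V s by apply.
apply: (divV a Fa) => r ar; apply/annS_act => y Vy.
by rewrite actM act_phi; apply: saV; exact: ideal_modZ.
Qed.

Lemma F_divisible_ann_prime V : submodule V -> is_prime (annS phi m V) ->
  ~ F (contr phi (annS phi m V)) -> F_divisible F V.
Proof.
move=> sV prV nFV; apply: F_divisible_ann => // a Fa s saV; apply: contrapT => nVs.
apply: nFV; apply: (upF Fa); first exact/contr_ideal/prime_ideal.
move=> r /saV; rewrite mulrC => Vrs; exact: (primeMr prV Vrs nVs).
Qed.

Lemma F_divisible_image V (f : E -> E) : F_divisible F V -> submodule V ->
  (forall a x y, V x -> V y -> f (a *: x + y) = a *: f x + f y) ->
  F_divisible F (fun y => exists2 x, V x & f x = y).
Proof.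
move=> divV sV linf a Fa y.
have f0 : f 0 = 0.
  have := linf (-1) 0 0 (submodule0 sV) (submodule0 sV).
  by rewrite !scaleN1r oppr0 addr0 addNr.
have fZ r x : V x -> f (r *: x) = r *: f x.
  by move=> Vx; rewrite -[r *: x]addr0 linf ?f0 ?addr0 //; exact: submodule0.
have fD x z : V x -> V z -> f (x + z) = f x + f z.
  by move=> Vx Vz; rewrite -[x]scale1r linf // !scale1r.
split=> [[x Vx <-]|].
  suff: V x /\ ideal_mod a (fun y => exists2 x, V x & f x = y) (f x) by case.
  have [/(_ Vx) + _] := divV a Fa x.
  elim=> [|r z ar Vz|u v _ [Vu fu] _ [Vv fv]].
  - by split; [exact: submodule0|rewrite f0; exact: ideal_mod0].
  - split; first exact: submoduleZ.
    by rewrite fZ //; apply: ideal_modZ => //; exists z.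
  - by split; [exact: submoduleD|rewrite fD //; exact: ideal_modD].
elim=> [|r _ _ [x Vx <-]|_ _ _ [x Vx <-] _ [z Vz <-]].
- by exists 0; [exact: submodule0|].
- by exists (r *: x); [exact: submoduleZ|exact: fZ].
- by exists (x + z); [exact: submoduleD|exact: fD].
Qed.

Lemma not_F_divisible_killed V a : nonzeroM V -> F a ->
  (forall r x, a r -> V x -> r *: x = 0) -> ~ F_divisible F V.
Proof.
case=> x [Vx nx] Fa aV0 divV; apply: nx.
have /(divV a Fa) := Vx; apply: (@ideal_mod_sub _ _ a V (fun x => x = 0)) => //.
by split=> // [y z -> ->|r y ->]; rewrite ?addr0 ?scaler0.
Qed.

(** If [s * t] kills [V] and [t] maps onto [V], then [s] kills [V]. *)
Lemma annS_prime V : submodule V -> nonzeroM V ->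
  (forall s, ~ annS phi m V s -> forall y, V y -> exists2 x, V x & act s x = y) ->
  is_prime (annS phi m V).
Proof.
move=> sV [x0 [Vx0 nx0]] surj; split; first exact: annS_ideal.
  by move=> /annS_act /(_ x0 Vx0); rewrite act1.
move=> s t /annS_act stV; apply: contrapT => /not_orP[nVs nVt].
apply: nVs; apply/annS_act => y Vy; have [x Vx <-] := surj t nVt y Vy.
by rewrite -actM stV.
Qed.

Variable N : E -> Prop.
Hypotheses (sN : submodule N) (nzN : nonzeroM N).

(** The image of a nonzero endomorphism is a nonzero divisible submodule, hence all of [N]. *)
Lemma simple_strongly_coprime : simple_F_divisible F N -> strongly_coprime N.
Proof.
case=> _ divN simN; split=> // f fN linf [x [Nx nfx]] y Ny.
pose V y := exists2 x, N x & f x = y.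
suff [z Nz fz] : V y by exists z.
apply: contrapT => nVy; apply: (simN V).
- split.
  + exists 0; first exact: submodule0.
    have := linf (-1) 0 0 (submodule0 sN) (submodule0 sN).
    by rewrite !scaleN1r oppr0 addr0 addNr.
  + move=> _ _ [u Nu <-] [v Nv <-]; exists (1 *: u + v).
      by rewrite scale1r; exact: submoduleD.
    by rewrite linf // scale1r.
  + move=> r _ [u Nu <-]; exists ((r - 1) *: u + u).
      by apply: submoduleD => //; exact: submoduleZ.
    by rewrite linf // scalerBl scale1r subrK.
- by move=> _ [z Nz <-]; exact: fN.
- by exists (f x); split=> //; exists x.
- by move/(_ y Ny).
- exact: F_divisible_image.
Qed.

Lemma strongly_coprime_annS_prime : strongly_coprime N -> is_prime (annS phi m N).
Proof.
case=> _ scN; apply: annS_prime => // s nNs y Ny.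
have [|||x [Nx sx]] := scN (act s) _ _ _ y Ny; last by exists x.
- by move=> x; exact: act_submodule.
- by move=> a x z _ _; exact: act_linear.
- apply: contrapT => nx; apply: nNs; apply/annS_act => x Nx.
  by apply: contrapT => nsx; apply: nx; exists x.
Qed.

Lemma contr_annS r : contr phi (annS phi m N) r <-> annR N r.
Proof.
split=> [/annS_act rN x Nx|rN]; first by rewrite -act_phi rN.
by apply/annS_act => x Nx; rewrite act_phi rN.
Qed.

Lemma simple_contr_notin : simple_F_divisible F N -> ~ F (contr phi (annS phi m N)).
Proof.
case=> _ divN _ FN; apply: (not_F_divisible_killed nzN FN) => // r x /contr_annS.
exact.
Qed.

(** For a competing prime [P] containing [Ann_S N], duality makes [Ann_E P] a nonzero divisible
    submodule of [N]. It is therefore [N], so [P] kills [N]. *)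
Lemma simple_max_nonF_prime :
  simple_F_divisible F N -> max_nonF_prime phi F (annS phi m N).
Proof.
move=> simN; split; [exact/strongly_coprime_annS_prime/simple_strongly_coprime| |].
  exact: simple_contr_notin.
move=> P prP nFP NP s Ps; have [_ _ simV] := simN.
have idP := prime_ideal prP.
have sV := ann_module_submodule P.
have VE t : annS phi m (ann_module P) t <-> P t.
  by split=> [|Pt]; [exact: annS_ann_module|apply/annS_act => x; exact].
have VN : subM (ann_module P) N.
  by move=> x Px; apply: ann_module_annS => // t /NP; exact: Px.
suff NV : subM N (ann_module P) by apply/annS_act => x /NV; exact.
apply: contrapT => nNV; apply: (simV _ sV VN _ nNV).
  apply: contrapT => nzV; apply: (prime_not1 prP); apply/VE/annS_act => x Px.
  by rewrite act1; apply: contrapT => nx; apply: nzV; exists x.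
have VP : annS phi m (ann_module P) = P by apply/funext => t; apply/propext.
by apply: F_divisible_ann_prime; rewrite ?VP.
Qed.

(* If [V] is a proper divisible submodule of [N], the annihilator of a minimal
   nonzero [s V] is a prime in the set strictly containing [Ann_S N]. *)
Lemma max_nonF_prime_simple :
  max_nonF_prime phi F (annS phi m N) -> simple_F_divisible F N.
Proof.
case=> prN nFN maxN; split=> //; first exact: F_divisible_ann_prime.
move=> V sV VN nzV nNV divV; apply: nNV => x Nx; apply: ann_module_annS => // t.
pose image s y := exists2 x, V x & act s x = y.
have sI s : submodule (image s).
  have lins := act_linear s; split.
  - by exists 0; [exact: submodule0|exact: is_linear0].
  - move=> _ _ [u Vu <-] [v Vv <-]; exists (u + v); first exact: submoduleD.
    exact: is_linearD.
  - move=> r _ [u Vu <-]; exists (r *: u); first exact: submoduleZ.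
    exact: is_linearZ.
have [|W [sW [s WE [w [Ww nw]]] minW]] := @artinian_min _ _ _
    (fun W => exists2 s, W = image s & nonzeroM W) artinian_hull.
  exists (image 1); split=> //; exists 1 => //.
  by case: nzV => v [Vv nv]; exists v; split=> //; exists v; rewrite ?act1.
have nzW : nonzeroM W by exists w.
have WV : subM W V by rewrite WE => _ [v Vv <-]; exact: act_submodule.
(* An element [u] not killing [W = s V] maps it onto the nonzero image [(u s) V] inside [W], which
   is [W] by minimality. *)
have prW : is_prime (annS phi m W).
  apply: annS_prime => // u nWu y Wy.
  suff [v Vv <-] : image (u * s) y.
    by exists (act s v); [rewrite WE; exists v|rewrite actM].
  apply: (minW (image (u * s))) => //.
    exists (u * s) => //; apply: contrapT => nz; apply: nWu; apply/annS_act => z.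
    rewrite WE => -[v Vv <-]; apply: contrapT => nuv; apply: nz.
    by exists (act u (act s v)); split=> //; exists v; rewrite ?actM.
  move=> _ [v Vv <-]; rewrite actM; apply: act_submodule => //.
  by rewrite WE; exists v.
have nFW : ~ F (contr phi (annS phi m W)).
  move=> FW; apply: (not_F_divisible_killed nzW FW).
    by move=> r z /annS_act rW Wz; rewrite -act_phi rW.
  rewrite WE; apply: F_divisible_image => // a y z _ _; exact: act_linear.
move=> /annS_act tV; suff /annS_act : annS phi m N t by apply.
(* Maximality gives [Ann_S W = Ann_S N], so [t], which kills [V] and hence [W], kills [N]. *)
apply: (maxN _ prW nFW).
  by move=> u /annS_act uN; apply/annS_act => z /WV /VN; exact: uN.
by apply/annS_act => z /WV; exact: tV.
Qed.

Hypothesis GU : going_up phi.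

(** Going up lifts a larger prime [q] outside [F] to a prime above [Ann_S N], where maximality
    already holds. *)
Lemma simple_Fstar : simple_F_divisible F N -> Fstar F (annR N).
Proof.
move=> simN; have [prN nFN maxN] := simple_max_nonF_prime simN.
have NE : contr phi (annS phi m N) = annR N.
  by apply/funext => r; apply/propext; exact: contr_annS.
rewrite -NE; have prR := contr_prime phi prN; split=> // q prq nFq Nq.
have [Q [prQ NQ Qq]] := GU prR prq Nq prN (fun=> iff_refl _).
move=> r /Qq; apply: maxN => //; move=> FQ; apply: nFq.
by apply: (upF FQ); [exact: prime_ideal|move=> t /Qq].
Qed.

(** A competing prime above [Ann_S N] has contraction [Ann_R N], by maximality in [F^*];
    incomparability in the fibre then makes it equal to [Ann_S N]. *)
Lemma strongly_coprime_max_nonF_prime : strongly_coprime N -> Fstar F (annR N) ->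
  max_nonF_prime phi F (annS phi m N).
Proof.
move=> scN [prN nFN maxN]; have prI := strongly_coprime_annS_prime scN.
have NE : contr phi (annS phi m N) = annR N.
  by apply/funext => r; apply/propext; exact: contr_annS.
split=> //; first by rewrite NE.
move=> P prP nFP NP; apply: (going_up_incomparable noethR) locm _ GU _ _ _ _ _ _ => //.
- exact: completion_noetherian.
- move=> s; have [/(_ 1 s)[r sr] _ _ _] := complS; exists r.
  apply: ext_ideal_mono sr => t; elim=> [|a b ma _|x y _ mx _ my].
  + exact: ideal0.
  + exact: ideal_mulr.
  + exact: idealD.
- rewrite NE; apply: maxN => //; first exact: contr_prime.
  by rewrite -NE => r; exact: NP.
Qed.

End Divisibility.

End Completion.
End InjectiveHull.

Theorem theorem3p5 (R : comNzRingType) (m : R -> Prop)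
  (S : comNzRingType) (phi : {rmorphism R -> S})
  (F : (R -> Prop) -> Prop) (E : lmodType R) (N : E -> Prop) :
  noetherian R -> is_local_max m -> is_completion phi m ->
  gabriel_topology F -> injective_hull_residue E m ->
  submodule N -> nonzeroM N ->
  (simple_F_divisible F N <-> max_nonF_prime phi F (annS phi m N)) /\
  (going_up phi ->
     (simple_F_divisible F N <-> (strongly_coprime N /\ Fstar F (annR N)))).
Proof.
move=> noethR locm complS gabF [injE [e0 [ann_e0 ess_e0]]] sN nzN.
have [act actE] := completion_action noethR locm ann_e0 ess_e0 complS.
have simple_max : simple_F_divisible F N <-> max_nonF_prime phi F (annS phi m N).
  split.
  - exact: (simple_max_nonF_prime noethR locm ann_e0 ess_e0 injE complS actE gabF sN nzN).
  - exact: (max_nonF_prime_simple noethR locm ann_e0 ess_e0 injE complS actE gabF sN nzN).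
split=> // GU; split=> [simN|[scN FN]].
  split; first exact: (simple_strongly_coprime sN nzN simN).
  exact: (simple_Fstar noethR locm ann_e0 ess_e0 injE complS actE gabF sN nzN GU simN).
apply/simple_max.
exact: (strongly_coprime_max_nonF_prime noethR locm ann_e0 ess_e0 injE complS actE
  sN nzN GU scN FN).
Qed.
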